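(* Let $p$ be a prime such that $2$ is a primitive root modulo $p$. Then for every natural number $x$, $$S_p(2^p x) = p\, S_p(2x).$$
   Context: For $m, x \in \mathbb{N}$, the Newman sum is $S_m(x)=\sum_{0\le n<x,\ n\equiv 0 \pmod m} (-1)^{\sigma(n)}$, where $\sigma(n)$ denotes the number of 1's in the binary expansion of $n$. *)

(* Defs.v *)
From mathcomp Require Import all_boot all_order all_algebra.

Set Implicit Arguments.
Unset Strict Implicit.
Unset Printing Implicit Defensive.

Local Open Scope ring_scope.

(* The i-th binary digit of n is the parity of n %/ 2 ^ i. As n < 2 ^ n, every
   digit equal to 1 has index i < n. *)
Definition sigma (n : nat) : nat := (\sum_(0 <= i < n) odd (n %/ 2 ^ i))%N.

Definition newman_sum (m x : nat) : int :=
  \sum_(0 <= n < x | (n == 0 %[mod m])%N) (-1) ^+ sigma n.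

(* Main.v *)
Require Import Defs.
From mathcomp Require Import all_boot all_order all_algebra.
From mathcomp Require Import all_field ring zify.

Set Implicit Arguments.
Unset Strict Implicit.
Unset Printing Implicit Defensive.

Import GRing.Theory Num.Theory.

Local Open Scope ring_scope.

(* Averaging over the p-th roots of unity w, p S_p(N) is the sum of the values
   at w of F_N(X) = \sum_(n < N) (-1)^sigma(n) X^n. The binary digits of n give
   F_(2^k N)(w) = \prod_(j < k) (1 - w^(2^j)) * F_N(w^(2^k)). If w <> 1, then as
   2 is a primitive root the exponents 2^j with j < p - 1 run over the nonzero
   residues mod p, so these factors multiply to p and
   F_(2^p x)(w) = p (1 - w) F_x(w^2) = p F_(2x)(w). If w = 1 both vanish. *)

(** Digits of index at least [n] vanish because [n < 2 ^ n]. The freedom in the bound lets digit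
    sums of different numbers be compared index by index. *)
Lemma sigma_widen n m : (n <= m)%N ->
  sigma n = (\sum_(0 <= i < m) odd (n %/ 2 ^ i))%N.
Proof.
move=> le_nm; rewrite /sigma [RHS](big_cat_nat (n := n)) //=.
rewrite -[LHS]addn0; congr (_ + _)%N; rewrite big_nat_cond big1 // => i.
rewrite andbT => /andP[le_ni _].
by rewrite divn_small // (leq_trans (ltn_expl n (isT : 1 < 2)%N)) // leq_exp2l.
Qed.

Lemma sigma_double_add (b : bool) n : sigma (b + n.*2) = (b + sigma n)%N.
Proof.
(* The successor keeps the range nonempty, so that digit 0 can be split off even when [b + n.*2] is
   0. *)
rewrite (@sigma_widen _ (b + n.*2).+1) // big_nat_recl //= divn1 oddD odd_double.
rewrite addbF oddb; congr (_ + _)%N.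
rewrite (@sigma_widen n (b + n.*2)); last by lia.
apply: eq_bigr => i _; rewrite expnS divnMA; congr (nat_of_bool (odd (_ %/ _))).
by case: b; lia.
Qed.

Section ThueMorsePolynomial.

Variable R : comNzRingType.

Definition thue_morse_poly (N : nat) (u : R) : R :=
  \sum_(0 <= n < N) (-1) ^+ sigma n * u ^+ n.

(** The exponents [2n] and [2n + 1] carry opposite signs, so each such pair contributes a factor
    [1 - u]. *)
Lemma thue_morse_poly_double N u :
  thue_morse_poly (2 * N) u = (1 - u) * thue_morse_poly N (u ^+ 2).
Proof.
rewrite /thue_morse_poly; elim: N => [|N IH]; first by rewrite muln0 !big_geq ?mulr0.
rewrite mulnS !addSn add0n !big_nat_recr //= IH mul2n.
rewrite (sigma_double_add false) (sigma_double_add true) /= add0n add1n.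
rewrite (exprS u N.*2) (exprS (-1)) -mul2n exprM.
ring.
Qed.

Lemma thue_morse_poly_exp2 k N u :
  thue_morse_poly (2 ^ k * N) u =
  \prod_(j < k) (1 - u ^+ (2 ^ j)) * thue_morse_poly N (u ^+ (2 ^ k)).
Proof.
elim: k N => [|k IH] N; first by rewrite big_ord0 mul1r mul1n expr1.
rewrite expnSr -mulnA IH thue_morse_poly_double big_ord_recr /= mulrA.
by rewrite exprM.
Qed.

End ThueMorsePolynomial.

Lemma sum_prim_root_exp (F : fieldType) p (z : F) n : p.-primitive_root z ->
  \sum_(k < p) (z ^+ k) ^+ n = if (p %| n)%N then p%:R else 0.
Proof.
move=> prim_z; under eq_bigr do rewrite exprAC.
rewrite (prim_order_dvd prim_z); case: eqP => [-> | /eqP zn_neq1].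
  by under eq_bigr do rewrite expr1n; rewrite sumr_const card_ord.
have /eqP := subrX1 (z ^+ n) p.
rewrite exprAC (prim_expr_order prim_z) expr1n subrr eq_sym mulf_eq0 subr_eq0.
by rewrite (negPf zn_neq1) => /eqP.
Qed.

(** After exchanging the sums, orthogonality of the powers of [z] keeps exactly the multiples of
    [p]. *)
Lemma newman_sum_thue_morse p N (z : algC) : p.-primitive_root z ->
  p%:R * (newman_sum p N)%:~R = \sum_(k < p) thue_morse_poly N (z ^+ k).
Proof.
move=> prim_z; rewrite exchange_big /newman_sum rmorph_sum /= mulr_sumr big_mkcond /=.
apply: eq_bigr => n _; rewrite -mulr_sumr (sum_prim_root_exp n prim_z) mod0n /dvdn.
by case: ifP; rewrite ?mulr0 // rmorphXn /= rmorphN rmorph1 mulrC.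
Qed.

(** Cancel [X - 1] from two factorizations of [X^n - 1], then evaluate at 1. *)
Lemma prod_1_sub_prim_root (F : fieldType) n (z : F) : n.-primitive_root z ->
  \prod_(1 <= i < n) (1 - z ^+ i) = n%:R.
Proof.
move=> prim_z; have n_gt0 := prim_order_gt0 prim_z.
have := factor_Xn_sub_1 prim_z; rewrite big_ltn // expr0 subrX1.
move/mulfI; rewrite polyXsubC_eq0 => /(_ isT) /(congr1 (horner^~ 1)).
rewrite horner_prod horner_sum; under eq_bigr do rewrite hornerXsubC.
move=> ->; under eq_bigr do rewrite hornerXn expr1n.
by rewrite sumr_const card_ord.
Qed.

Section PrimitiveRootTwo.

Variables (p : nat) (hp : prime p).
Hypothesis h2 : p.-1.-primitive_root (2%:R : 'F_p).

(** The residues of the [2 ^ j] are distinct and nonzero; being [p - 1] in number, they permute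
    [1, ..., p - 1]. *)
Lemma prod_exp2_prim_root (V : comNzRingType) (G : nat -> V) :
  \prod_(j < p.-1) G (2 ^ j %% p)%N = \prod_(1 <= i < p) G i.
Proof.
have p_gt0 := prime_gt0 hp.
pose s := [seq (2 ^ j %% p)%N | j <- index_iota 0 p.-1].
have natE j : (2 ^ j %% p)%N = (2%:R ^+ j : 'F_p).
  by rewrite -natrX val_Fp_nat.
have uniq_s : uniq s.
  rewrite map_inj_in_uniq ?iota_uniq // => i j.
  rewrite !mem_index_iota /= => lt_i lt_j.
  rewrite !natE => /val_inj/eqP; rewrite (eq_prim_root_expr h2).
  by rewrite !modn_small // => /eqP.
have sub_s : {subset s <= index_iota 1 p}.
  move=> _ /mapP[j _ ->]; rewrite mem_index_iota ltn_mod p_gt0 andbT lt0n natE.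
  apply/eqP => /(@val_inj _ _ _ (2%:R ^+ j : 'F_p) 0)/eqP.
  (* If 2 were 0 in ['F_p], its power of positive exponent [p.-1] would be 0 instead of 1. *)
  rewrite expf_eq0 => /andP[_ /eqP two0]; have := prim_expr_order h2.
  rewrite two0 expr0n; case: eqP (prim_order_gt0 h2) => [-> //|_ _ /eqP].
  by rewrite eq_sym oner_eq0.
have [|_ eq_s] := uniq_min_size uniq_s sub_s.
  by rewrite size_map !size_iota subn0 subn1.
rewrite -(perm_big _ (uniq_perm uniq_s (iota_uniq _ _) eq_s)).
by rewrite big_map big_mkord.
Qed.

Lemma exp2_pred_mod : (2 ^ p.-1 = 1 %[mod p])%N.
Proof.
have : (2 ^ p.-1)%:R = 1%:R :> 'F_p by rewrite natrX (prim_expr_order h2).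
by move/(congr1 (@nat_of_ord _)); rewrite !val_Fp_nat.
Qed.

Lemma thue_morse_poly_exp2_prime x (w : algC) : w ^+ p = 1 ->
  thue_morse_poly (2 ^ p * x) w = p%:R * thue_morse_poly (2 * x) w.
Proof.
move=> wp1; have [-> | w_neq1] := eqVneq w 1.
  rewrite !thue_morse_poly_double -(prednK (prime_gt0 hp)) expnS -mulnA.
  by rewrite thue_morse_poly_double subrr !mul0r mulr0.
have prim_w : p.-primitive_root w.
  (* The order of [w] divides the prime [p] and is not 1. *)
  have [m prim_m] := prim_order_exists (prime_gt0 hp) wp1.
  case/primeP: hp => _ H /H /orP[] /eqP E; move: prim_m; rewrite E //.
  by move/prim_expr_order/eqP; rewrite expr1 (negPf w_neq1).
have prod_w : \prod_(j < p.-1) (1 - w ^+ (2 ^ j)) = p%:R.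
  under eq_bigr do rewrite -(prim_expr_mod prim_w).
  by rewrite (prod_exp2_prim_root (fun i => 1 - w ^+ i)) prod_1_sub_prim_root.
have w2 : w ^+ (2 ^ p.-1) = w.
  by rewrite -(prim_expr_mod prim_w) exp2_pred_mod prim_expr_mod.
(* Only [p - 1] doublings are unfolded; the remaining factor 2 stays with [x]. *)
rewrite -(prednK (prime_gt0 hp)) expnSr -mulnA thue_morse_poly_exp2.
by rewrite prod_w w2 prednK ?prime_gt0.
Qed.

End PrimitiveRootTwo.

Theorem theorem1 (p : nat) (hp : prime p)
    (h2 : p.-1.-primitive_root (2%:R : 'F_p)) (x : nat) :
  newman_sum p (2 ^ p * x)%N = p%:Z * newman_sum p (2 * x)%N.
Proof.
have p_gt0 := prime_gt0 hp; have [z prim_z] := C_prim_root_exists p_gt0.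
have p_neq0 : p%:R != 0 :> algC by rewrite pnatr_eq0 -lt0n.
(* The extra factor [p] turns both Newman sums into sums over the roots of unity, compared term by
   term. *)
apply: (@intr_inj algC); apply: (mulfI p_neq0).
rewrite rmorphM /= mulrCA !(newman_sum_thue_morse _ prim_z) mulr_sumr.
apply: eq_bigr => k _; apply: thue_morse_poly_exp2_prime => //.
by rewrite exprAC (prim_expr_order prim_z) expr1n.
Qed.
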